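(* Let $F$ and $H$ be graphs with $\chi(H)<\chi(F)=k+1$, and assume that $H$ is $F$-Turán-stable. Let $G$ be an $n$-vertex $F$-free graph which contains $\mathrm{ex}(n,H,F)$ copies of $H$. Then for every vertex $u$ of $G$ we have $d_G(H,u)\ge (1+o(1))\,d_{T(n,k)}(H,v)$, where $v$ is any vertex of $T(n,k)$ and $o(1)$ is as $n\to\infty$, uniformly over all such $G$, $u$ and $v$.
   Context: All graphs are finite and simple. $\mathcal{N}(H,G)$ is the number of (not necessarily induced) subgraphs of $G$ isomorphic to $H$ (copies of $H$), and $d_G(H,v)$ is the number of copies of $H$ in $G$ that contain the vertex $v$. A graph is $F$-free if it contains no copy of $F$ as a (not necessarily induced) subgraph. $\mathrm{ex}(n,H,F)$ is the maximum of $\mathcal{N}(H,G)$ over all $n$-vertex $F$-free graphs $G$. $T(n,k)$ denotes the complete $k$-partite $n$-vertex graph with each part of order $\lfloor n/k\rfloor$ or $\lceil n/k\rceil$; for any two vertices $u,v$ of $T(n,k)$ one has $d_{T(n,k)}(H,v)=(1+o(1))d_{T(n,k)}(H,u)$. Let $\chi(H)<\chi(F)=k+1$. $H$ is $F$-Turán-stable if: whenever $G$ is an $n$-vertex $F$-free graph with $\mathcal{N}(H,G)\ge \mathrm{ex}(n,H,F)-o(n^{|V(H)|})$, then $G$ can be obtained from $T(n,k)$ by adding and removing $o(n^2)$ edges. That is, for every $\varepsilon>0$ there are $\delta>0$ and $n_0$ such that every $F$-free graph $G$ on $n\ge n_0$ vertices with $\mathcal{N}(H,G)\ge \mathrm{ex}(n,H,F)-\delta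 n^{|V(H)|}$ can be obtained from (a copy on $V(G)$ of) $T(n,k)$ by adding and removing at most $\varepsilon n^2$ edges. *)

(* Defs.v *)
From HB Require Import structures.
From mathcomp Require Import all_boot all_order all_algebra.
From mathcomp Require Import reals.

Set Implicit Arguments.
Unset Strict Implicit.
Unset Printing Implicit Defensive.

Import Order.TTheory GRing.Theory Num.Theory.

Local Open Scope nat_scope.

Record sgraph (V : finType) := SGraph {
  edges : {set {set V}};
  _ : [forall e in edges, #|e| == 2] }.

HB.instance Definition _ (V : finType) := [isSub for @edges V].
HB.instance Definition _ (V : finType) := [Finite of sgraph V by <:].

Definition adj (V : finType) (G : sgraph V) : rel V :=
  fun x y => [set x; y] \in edges G.

Definition colorable (V : finType) (G : sgraph V) (k : nat) : bool :=
  [exists c : {ffun V -> 'I_k}, forall x, forall y, adj G x y ==> (c x != c y)].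

Lemma colorable_card (V : finType) (G : sgraph V) : exists k, colorable G k.
Proof.
exists #|V|; apply/existsP; exists [ffun x => enum_rank x].
apply/forallP=> x; apply/forallP=> y; apply/implyP=> Gxy.
rewrite !ffunE (inj_eq enum_rank_inj).
have /forall_inP/(_ _ Gxy) := valP G; rewrite cards2.
by case: (x == y).
Qed.

Definition chromatic_number (V : finType) (G : sgraph V) : nat :=
  ex_minn (colorable_card G).

(* A subgraph is recorded as (vertex set, edge set), so that isolated vertices
   of H are accounted for; copies differing only in their vertex set are
   distinct. *)
Definition copies (VH V : finType) (H : sgraph VH) (G : sgraph V) :
    {set {set V} * {set {set V}}} :=
  [set P : {set V} * {set {set V}} | (P.2 \subset edges G) &&
    [exists f : {ffun VH -> V},
      [&& injectiveb f, P.1 == f @: [set: VH]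
        & P.2 == [set f @: (e : {set VH}) | e in edges H]]]].

Definition num_copies (VH V : finType) (H : sgraph VH) (G : sgraph V) : nat :=
  #|copies H G|.

Definition copy_degree (VH V : finType) (H : sgraph VH) (G : sgraph V)
    (v : V) : nat :=
  #|[set P in copies H G | v \in P.1]|.

Definition is_free (VF V : finType) (F : sgraph VF) (G : sgraph V) : bool :=
  copies F G == set0.

(* ex(n, H, F); the value is 0 when there is no F-free graph on n vertices. *)
Definition gen_turan (VH VF : finType) (n : nat) (H : sgraph VH) (F : sgraph VF) :
    nat :=
  \max_(G : sgraph 'I_n | is_free F G) num_copies H G.

(* T is (a copy on V of) T(#|V|, k); (#|V| + k.-1) %/ k is the ceiling of
   #|V| / k. *)
Definition is_turan (V : finType) (k : nat) (T : sgraph V) : Prop :=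
  exists2 c : V -> 'I_k,
    forall x y, adj T x y = (c x != c y) &
    forall i, #|[set x | c x == i]| \in [:: #|V| %/ k; (#|V| + k.-1) %/ k].

Definition edit_distance (V : finType) (G T : sgraph V) : nat :=
  #|(edges G :\: edges T) :|: (edges T :\: edges G)|.

(* Meant for chromatic_number H < chromatic_number F = k.+1. *)
Definition turan_stable (R : realType) (VH VF : finType) (k : nat)
    (H : sgraph VH) (F : sgraph VF) : Prop :=
  (forall eps : R, 0 < eps ->
   exists delta : R, exists n0 : nat, 0 < delta /\
   forall (n : nat) (V : finType) (G : sgraph V),
     (n0 <= n)%N -> #|V| = n -> is_free F G ->
     (gen_turan n H F)%:R - delta * n%:R ^+ #|VH| <= (num_copies H G)%:R ->
     exists2 T : sgraph V, is_turan k T &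
       (edit_distance G T)%:R <= eps * n%:R ^+ 2)%R.

(* Main.v *)
Require Import Defs.
From HB Require Import structures.
From mathcomp Require Import all_boot all_order all_algebra.
From mathcomp Require Import perm reals zify ring lra.

Set Implicit Arguments.
Unset Strict Implicit.
Unset Printing Implicit Defensive.

Import Order.TTheory GRing.Theory Num.Theory.

(** By stability, [G] is close to some copy [T0] of T(n,k).  Fix the part of
    [T0] with the same colour as [v] and choose in it |V(F)| typical vertices,
    each missing few of the edges prescribed by [T0].  Delete the edges at [u]
    and join [u] to the common neighbourhood of these typical vertices.  The new
    graph is still F-free, since in a copy of F the vertex [u] could be exchanged
    for an unused typical vertex; as [G] is extremal, the degree of [u] cannot
    have increased.  In the new graph [u] behaves like a vertex of T(n,k): a
    colour-preserving map sends all copies of H through [v] to copies through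
    [u], except for O(n^(h-1)/p) of them, where h = |V(H)| and p is as large as we
    please, whereas [v] lies in at least a constant times n^(h-1) copies since
    [H] is k-colourable. *)

(** * Copies as images of injective homomorphisms *)

Lemma card_edge (V : finType) (G : sgraph V) e : e \in edges G -> #|e| = 2.
Proof. by move=> eG; have /forall_inP/(_ _ eG)/eqP := valP G. Qed.

Lemma adj_neq (V : finType) (G : sgraph V) x y : adj G x y -> x != y.
Proof. by move=> /card_edge; rewrite cards2; case: eqP. Qed.

Lemma adj_sym (V : finType) (G : sgraph V) x y : adj G x y = adj G y x.
Proof. by rewrite /adj setUC. Qed.

Definition hom (VH V : finType) (H : sgraph VH) (G : sgraph V) (f : VH -> V) :=
  forall x y, adj H x y -> adj G (f x) (f y).

Definition image_copy (VH V : finType) (H : sgraph VH) (f : VH -> V) :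
    {set V} * {set {set V}} :=
  (f @: [set: VH], [set f @: (e : {set VH}) | e in edges H]).

Lemma copiesP (VH V : finType) (H : sgraph VH) (G : sgraph V) P :
  reflect (exists f : VH -> V, [/\ injective f, hom H G f & P = image_copy H f])
          (P \in copies H G).
Proof.
case: P => A E; rewrite inE /=; apply: (iffP andP) => [[EG /existsP[f]]|[f [fI fH [-> ->]]]].
  case/and3P=> /injectiveP fI /eqP eA /eqP eE; exists f; split => //; last first.
    by rewrite /image_copy -eA -eE.
  move=> x y xy; apply: (subsetP EG); rewrite eE; apply/imsetP.
  by exists [set x; y] => //; rewrite imsetU1 imset_set1.
split.
  apply/subsetP=> _ /imsetP[e eH ->]; have /eqP/cards2P[x [y [_ ee]]] := card_edge eH.
  by have := fH x y; rewrite /adj -ee => /(_ eH); rewrite ee imsetU1 imset_set1.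
have ff (B : {set VH}) : finfun f @: B = f @: B by apply: eq_imset => x; rewrite ffunE.
apply/existsP; exists (finfun f); apply/and3P; split.
- by apply/injectiveP=> x y; rewrite !ffunE; apply: fI.
- by rewrite ff.
- by apply/eqP; apply: eq_in_imset => e _; rewrite ff.
Qed.

Lemma copies_card (VH V : finType) (H : sgraph VH) (G : sgraph V) P :
  P \in copies H G -> #|P.1| = #|VH|.
Proof. by case/copiesP=> f [fI _ ->]; rewrite card_imset // cardsT. Qed.

Lemma copies_powerset (VH V : finType) (H : sgraph VH) (G : sgraph V) P :
  P \in copies H G -> P.2 \subset powerset P.1.
Proof.
case/copiesP=> f [fI _ ->] /=; apply/subsetP=> _ /imsetP[e _ ->].
by rewrite inE; apply: imsetS; apply: subsetT.
Qed.

Definition push (V W : finType) (g : V -> W) (P : {set V} * {set {set V}}) :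
    {set W} * {set {set W}} :=
  (g @: P.1, [set g @: (e : {set V}) | e in P.2]).

Lemma push_image_copy (VH V W : finType) (H : sgraph VH) (f : VH -> V) (g : V -> W) :
  push g (image_copy H f) = image_copy H (g \o f).
Proof.
rewrite /push /image_copy /= -imset_comp; congr pair; rewrite -imset_comp.
by apply: eq_in_imset => e _ /=; rewrite -imset_comp.
Qed.

(** Every edge lies inside the vertex set, hence inside [A], where [g'] undoes [g]. This is how
    [push g] is shown to be injective on copies. *)
Lemma pushK (V W : finType) (A : {set V}) (g : V -> W) (g' : W -> V)
    (P : {set V} * {set {set V}}) :
  {in A, cancel g g'} -> P.1 \subset A -> P.2 \subset powerset P.1 ->
  push g' (push g P) = P.
Proof.
case: P => X E /= gK XA EX.
have K (Y : {set V}) : Y \subset A -> g' @: (g @: Y) = Y.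
  move=> YA; rewrite -imset_comp -[RHS]imset_id; apply: eq_in_imset => x xY /=.
  by apply: gK; apply: (subsetP YA).
rewrite /push /= K //; congr pair; rewrite -imset_comp -[RHS]imset_id.
apply: eq_in_imset => e eE /=; apply: K; apply: subset_trans XA.
by have := subsetP EX _ eE; rewrite inE.
Qed.

(** Members that are not pairs are dropped, so any family of vertex sets yields a simple graph. *)
Definition graph_of (V : finType) (E : {set {set V}}) : sgraph V.
Proof.
by exists [set e in E | #|e| == 2]; apply/forall_inP=> e; rewrite inE => /andP[].
Defined.

Lemma adj_graph_of (V : finType) (E : {set {set V}}) x y :
  adj (graph_of E) x y = ([set x; y] \in E) && (x != y).
Proof. by rewrite /adj inE cards2; case: (x != y). Qed.

Lemma is_freeP (VF V : finType) (F : sgraph VF) (G : sgraph V) :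
  reflect (forall f : VF -> V, injective f -> ~ hom F G f) (is_free F G).
Proof.
apply: (iffP eqP) => [F0 f fI fH|Ff].
  have : image_copy F f \in copies F G by apply/copiesP; exists f.
  by rewrite F0 inE.
by apply/setP=> P; rewrite in_set0; apply/negP => /copiesP[f [fI fH _]]; apply: (Ff f).
Qed.

(** * Extremality and changes at a single vertex *)

(** The maximum in [gen_turan] runs over graphs on an ordinal type, so [G] and its copies are
    transported along [enum_rank]. *)
Lemma num_copies_le_gen_turan (VH VF V : finType) (H : sgraph VH) (F : sgraph VF)
    (G : sgraph V) :
  is_free F G -> num_copies H G <= gen_turan #|V| H F.
Proof.
move=> /is_freeP Ffree.
pose G' := graph_of [set (enum_rank @: (e : {set V})) | e in edges G].
have adjE i j : adj G' i j = adj G (enum_val i) (enum_val j).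
  rewrite adj_graph_of.
  have -> : [set i; j] = enum_rank @: [set enum_val i; enum_val j].
    by rewrite imsetU1 imset_set1 !enum_valK.
  rewrite mem_imset; last exact/imset_inj/enum_rank_inj.
  rewrite -/(adj G _ _); case ij: (adj G _ _) => //=.
  by have := adj_neq ij; rewrite (inj_eq enum_val_inj).
have G'free : is_free F G'.
  apply/is_freeP => f fI fH; apply: (Ffree (enum_val \o f)).
    by apply: inj_comp => //; apply: enum_val_inj.
  by move=> x y /fH; rewrite adjE.
apply: leq_trans (leq_bigmax_cond _ G'free); rewrite /num_copies.
rewrite -(@card_in_imset _ _ (push enum_rank)).
  apply: subset_leq_card; apply/subsetP => _ /imsetP[P /copiesP[f [fI fH ->]] ->].
  rewrite push_image_copy; apply/copiesP; exists (enum_rank \o f); split => //.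
    by apply: inj_comp => //; apply: enum_rank_inj.
  by move=> x y /fH; rewrite adjE /= !enum_rankK.
apply: (can_in_inj (g := push enum_val)) => P /copies_powerset PS.
apply: (@pushK _ _ setT) => // x _; exact: enum_rankK.
Qed.

Lemma copies_off_sub (VH V : finType) (H : sgraph VH) (G G' : sgraph V) u :
  (forall x y, x != u -> y != u -> adj G x y -> adj G' x y) ->
  [set P in copies H G | u \notin P.1] \subset [set P in copies H G' | u \notin P.1].
Proof.
move=> GG'; apply/subsetP=> P; rewrite in_set => /andP[/copiesP[f [fI fH ->]] uf].
rewrite in_set uf andbT; apply/copiesP; exists f; split => // x y xy.
have fu z : f z != u.
  by apply: contraNneq uf => <-; rewrite /= imset_f.
by apply: GG'; [exact: fu|exact: fu|exact: fH].
Qed.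

Lemma num_copies_split (VH V : finType) (H : sgraph VH) (G : sgraph V) u :
  num_copies H G = copy_degree H G u + #|[set P in copies H G | u \notin P.1]|.
Proof.
rewrite /num_copies /copy_degree -(cardsID [set P : {set V} * {set {set V}} | u \in P.1] (copies H G)).
by congr (_ + _); apply: eq_card => P; rewrite !in_set // andbC.
Qed.

(** Copies avoiding [u] are the same in both graphs, so the totals differ exactly as the degrees of
    [u] do. *)
Lemma copy_degree_le (VH V : finType) (H : sgraph VH) (G G' : sgraph V) u :
  (forall x y, x != u -> y != u -> adj G' x y = adj G x y) ->
  num_copies H G' <= num_copies H G -> copy_degree H G' u <= copy_degree H G u.
Proof.
move=> E; rewrite !(num_copies_split _ _ u).
have -> : [set P in copies H G' | u \notin P.1] = [set P in copies H G | u \notin P.1].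
  by apply/eqP; rewrite eqEsubset !copies_off_sub // => x y xu yu; rewrite E.
by rewrite leq_add2r.
Qed.

(** A variant of Zykov symmetrization: the neighbourhood of [u] is replaced by [N], which need not
    be the neighbourhood of a single vertex. *)
Definition reattach (V : finType) (G : sgraph V) (u : V) (N : {set V}) : sgraph V :=
  graph_of ([set e in edges G | u \notin e] :|: [set [set u; y] | y in N]).

Lemma reattach_off (V : finType) (G : sgraph V) u N x y :
  x != u -> y != u -> adj (reattach G u N) x y = adj G x y.
Proof.
move=> xu yu; rewrite adj_graph_of !inE.
have -> : ([set x; y] \in [set [set u; z] | z in N]) = false.
  apply/negP => /imsetP[z _ /setP/(_ u)].
  by rewrite !inE eqxx ![u == _]eq_sym (negbTE xu) (negbTE yu).
rewrite ![u == _]eq_sym (negbTE xu) (negbTE yu) orbF andbT -/(adj G x y).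
by case xy: (adj G x y) => //=; rewrite (adj_neq xy).
Qed.

Lemma reattach_at (V : finType) (G : sgraph V) u (N : {set V}) y :
  u \notin N -> adj (reattach G u N) u y = (y \in N).
Proof.
move=> uN; rewrite adj_graph_of !inE eqxx /= andbF /=; apply/andP/idP => [[]|yN].
  move=> /imsetP[z zN /setP e] uy; have := e z; rewrite !inE eqxx orbT.
  by case/orP=> /eqP ez; [rewrite -ez zN in uN|rewrite -ez].
by split; [apply/imsetP; exists y|apply: contraNneq uN => ->].
Qed.

(** A copy of [F] through [u] has only [#|VF| - 1] other vertices, so it misses some [w] in [M].
    Since [w] is adjacent in [G] to all of [N], putting [w] in place of [u] gives a copy of [F] in
    [G]. *)
Lemma reattach_free (VF V : finType) (F : sgraph VF) (G : sgraph V) u (M N : {set V}) :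
  is_free F G -> u \notin M -> #|VF| <= #|M| -> u \notin N ->
  (forall x y, x \in M -> y \in N -> adj G x y) ->
  is_free F (reattach G u N).
Proof.
move=> /is_freeP Ffree uM cM uN MN; apply/is_freeP => f fI fH.
have [a fa|fu] := pickP (fun a => f a == u); last first.
  apply: (Ffree f) => // x y /fH; rewrite reattach_off //.
  - by rewrite fu. - by rewrite fu.
have /subsetPn[w wM wf] : ~~ (M \subset (f @: setT) :\ u).
  apply/negP => /subset_leq_card; rewrite leqNgt => /negP; apply.
  apply: leq_trans cM; rewrite -(cardsT VF) -(card_imset _ fI).
  by rewrite [X in _ < X](cardsD1 u) -(eqP fa) imset_f.
have wu : w != u by apply: contraNneq uM => <-.
have wf' b : w != f b.
  by apply/eqP=> wfb; move: wf; rewrite in_setD1 wu wfb imset_f.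
apply: (Ffree (fun b => if b == a then w else f b)) => [b c|b c bc].
  case: eqP => [->|ba]; case: eqP => [->|ca] //.
  - by move/eqP; rewrite (negbTE (wf' _)).
  - by move/eqP; rewrite eq_sym (negbTE (wf' _)).
  exact: fI.
have := fH _ _ bc; have := adj_neq bc.
have fau b' : (f b' == u) = (b' == a) by rewrite -(eqP fa) (inj_eq fI).
case: (eqVneq b a) => [->|ba]; case: (eqVneq c a) => [->|ca] _ //=.
- by rewrite (eqP fa) reattach_at // => /MN; apply.
- by rewrite (eqP fa) adj_sym reattach_at // => cN; rewrite adj_sym; apply: MN.
- by rewrite reattach_off ?fau.
Qed.

(** * Counting copies that contain prescribed vertices *)

Lemma bin_leq_exp n k : 'C(n, k) <= n ^ k.
Proof.
apply: (@leq_trans (n ^_ k)); first by rewrite -bin_ffact leq_pmulr ?fact_gt0.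
by rewrite ffact_prod -[X in _ <= _ ^ X]card_ord -prod_nat_const leq_prod // => i _; rewrite leq_subr.
Qed.

(** Removing [S] maps these sets injectively to sets of size [h - #|S|]. The case [h < #|S|] falls
    under the empty family. *)
Lemma card_supsets (V : finType) h (S : {set V}) :
  #|[set A : {set V} | (#|A| == h) && (S \subset A)]| * #|V| ^ #|S| <= #|V| ^ h.
Proof.
have [->|[A0]] := set_0Vmem [set A : {set V} | (#|A| == h) && (S \subset A)].
  by rewrite cards0.
rewrite inE => /andP[/eqP hA SA].
have sh : #|S| <= h by rewrite -hA subset_leq_card.
rewrite -{2}(subnK sh) expnD leq_mul2r; apply/orP; right.
apply: leq_trans (bin_leq_exp _ _); rewrite -card_draws.
rewrite -(@card_in_imset _ _ (fun A => A :\: S)) => [|A B]; last first.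
  rewrite !inE => /andP[_ SA1] /andP[_ SB] AB.
  by rewrite -(setID A S) -(setID B S) AB (setIidPr SA1) (setIidPr SB).
apply: subset_leq_card; apply/subsetP => _ /imsetP[A + ->].
by rewrite !inE => /andP[/eqP <- SA1]; rewrite cardsD (setIidPr SA1).
Qed.

(** A crude enclosure of the copies on [h] vertices that contain [S]: any family of subsets of the
    vertex set may serve as edge set, whence the factor [2 ^ 2 ^ h] in the bounds. *)
Definition containing (V : finType) h (S : {set V}) :=
  [set P : {set V} * {set {set V}} |
    ((#|P.1| == h) && (S \subset P.1)) && (P.2 \subset powerset P.1)].

(* The power [#|V| ^ #|S|] stands on the left because the truncated exponent
   [h - #|S|] would be wrong when [h < #|S|]. *)
Lemma card_containing (V : finType) h (S : {set V}) :
  #|containing h S| * #|V| ^ #|S| <= 2 ^ 2 ^ h * #|V| ^ h.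
Proof.
have -> : #|containing h S| =
    #|[set A : {set V} | (#|A| == h) && (S \subset A)]| * 2 ^ 2 ^ h.
  rewrite -sum1_card (eq_bigl (fun P : {set V} * {set {set V}} =>
    ((#|P.1| == h) && (S \subset P.1)) && (P.2 \subset powerset P.1))); last first.
    by move=> P; rewrite inE.
  rewrite -(pair_big_dep (fun A : {set V} => (#|A| == h) && (S \subset A))
    (fun (A : {set V}) (E : {set {set V}}) => E \subset powerset A) (fun _ _ => 1)) /=.
  rewrite (eq_bigr (fun _ => 2 ^ 2 ^ h)) => [|A /andP[/eqP hA _]].
    by rewrite sum_nat_const; congr (_ * _); apply: eq_card => A; rewrite inE.
  rewrite sum1_card -hA -(card_powerset A) -(card_powerset (powerset A)).
  by apply: eq_card => E; rewrite inE.
by rewrite mulnAC mulnC leq_mul2l card_supsets orbT.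
Qed.

Lemma card_bigcup_le (I T : finType) (A : {pred I}) (F : I -> {set T}) :
  #|\bigcup_(i in A) F i| <= \sum_(i in A) #|F i|.
Proof.
elim/big_rec2: _ => [|i m X _ IH]; first by rewrite cards0.
by apply: leq_trans (leq_card_setU _ _).1 _; rewrite leq_add2l.
Qed.

Lemma card_bigcup_containing (I V : finType) h (A : {set I}) (S : I -> {set V}) s :
  (forall i, i \in A -> #|S i| = s) ->
  #|\bigcup_(i in A) containing h (S i)| * #|V| ^ s <= #|A| * (2 ^ 2 ^ h * #|V| ^ h).
Proof.
move=> Ss; apply: leq_trans (leq_mul (card_bigcup_le _ _) (leqnn _)) _.
rewrite big_distrl -sum_nat_const; apply: leq_sum => i iA.
by rewrite /= -(Ss i iA) card_containing.
Qed.

Lemma copies_containing (VH V : finType) (H : sgraph VH) (G : sgraph V) P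
    (S : {set V}) :
  P \in copies H G -> S \subset P.1 -> P \in containing #|VH| S.
Proof.
move=> Pc SP; rewrite in_set SP (copies_powerset Pc) !andbT.
by rewrite (copies_card Pc).
Qed.

(** * Colour-preserving partial injections *)

Lemma subset_of_card (V : finType) (A : {set V}) m :
  exists2 A' : {set V}, A' \subset A & #|A'| = minn m #|A|.
Proof.
exists [set x in take m (enum A)].
  by apply/subsetP=> x; rewrite inE => /mem_take; rewrite mem_enum.
rewrite cardsE; have /card_uniqP -> : uniq (take m (enum A)) by rewrite take_uniq ?enum_uniq.
by rewrite size_take_min -cardE.
Qed.

(** Elements of [A] go to the elements of [B] with the same index; [u] is only the default of [nth].
    Domain and map form one pair, so that [fin_all_exists] can choose them for all colours at
    once. *)
Lemma partial_injection (W V : finType) (u : V) (A : {set W}) (B : {set V}) :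
  exists p : {set W} * (W -> V), [/\ p.1 \subset A, #|A :\: p.1| = #|A| - #|B|,
    {in p.1 &, injective p.2} & forall x, x \in p.1 -> p.2 x \in B].
Proof.
have [A' sA cA] := subset_of_card A #|B|.
have lt x : x \in A' -> index x (enum A') < #|B|.
  move=> xA; have : index x (enum A') < size (enum A') by rewrite index_mem mem_enum.
  by rewrite -cardE cA => /leq_trans; apply; rewrite geq_minl.
exists (A', fun x => nth u (enum B) (index x (enum A'))); split => //=.
- by rewrite cardsD (setIidPr sA) cA; lia.
- move=> x y xA yA /eqP; rewrite nth_uniq ?enum_uniq -?cardE ?lt // => /eqP.
  by move/(congr1 (nth x (enum A'))); rewrite !nth_index ?mem_enum.
- by move=> x xA; rewrite -mem_enum mem_nth // -cardE lt.
Qed.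

(** The classes are matched one colour at a time, with [v] and [u] set aside and matched to each
    other. Each colour loses at most [d] vertices, and images of different colours cannot
    collide. *)
Lemma coloured_injection (W V : finType) k (c : W -> 'I_k) (c' : V -> 'I_k) v u d :
  c v = c' u ->
  (forall i, #|[set x | c x == i] :\ v| <= #|[set x | c' x == i] :\ u| + d) ->
  exists W' : {set W}, exists psi : W -> V,
    [/\ v \in W', #|~: W'| <= k * d, psi v = u, {in W' &, injective psi} &
        {in W', forall x, c' (psi x) = c x}].
Proof.
move=> cvu dle.
have [p pP] := fin_all_exists (fun i =>
  partial_injection u ([set x | c x == i] :\ v) ([set x | c' x == i] :\ u)).
pose W' := v |: [set x | x \in (p (c x)).1].
pose psi x := if x == v then u else (p (c x)).2 x.
have inW x : x \in W' -> x != v -> [/\ x \in (p (c x)).1, psi x != u & c' (psi x) = c x].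
  rewrite !inE /psi => /orP[->//|xp] xv; rewrite (negbTE xv) xp.
  by have [_ _ _ /(_ _ xp)] := pP (c x); rewrite !inE => /andP[-> /eqP].
have psiv : psi v = u by rewrite /psi eqxx.
exists W', psi; split => //.
- by rewrite !inE eqxx.
- have sub : ~: W' \subset \bigcup_(i in 'I_k) (([set x | c x == i] :\ v) :\: (p i).1).
    apply/subsetP=> x; rewrite !inE negb_or => /andP[xv xp].
    by apply/bigcupP; exists (c x); rewrite // !inE xv xp eqxx.
  apply: leq_trans (subset_leq_card sub) _; apply: leq_trans (card_bigcup_le _ _) _.
  rewrite -[k in k * d]card_ord -sum_nat_const; apply: leq_sum => i _.
  by have [_ -> _ _] := pP i; rewrite leq_subLR.
- move=> x y xW yW; have [->|xv] := eqVneq x v; have [->|yv] := eqVneq y v => //.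
  + by rewrite psiv => e; have [_ + _] := inW y yW yv; rewrite -e eqxx.
  + by rewrite psiv => e; have [_ + _] := inW x xW xv; rewrite e eqxx.
  have [xp _ ex] := inW x xW xv; have [yp _ ey] := inW y yW yv => e.
  have cxy : c x = c y by rewrite -ex -ey e.
  move: e; rewrite /psi (negbTE xv) (negbTE yv) cxy; rewrite cxy in xp.
  by have [_ _ inj _] := pP (c y); apply: inj.
- move=> x xW; have [->|xv] := eqVneq x v; first by rewrite psiv.
  by have [] := inW x xW xv.
Qed.

(** * Comparing degrees, and a lower bound in the complete multipartite graph *)

(** Copies through [v] are moved by [psi] to [u]. A vertex outside [W'] or in [D] spoils O(n^(h-2))
    of them, as it occurs together with [v] or [u]; a pair in [B] spoils only O(n^(h-3)), as it
    occurs together with [u]. The factor [#|V| ^ 3] clears these denominators. *)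
Lemma copy_degree_compare (VH V W : finType) (H : sgraph VH) (G : sgraph V)
    (T : sgraph W) k (c : W -> 'I_k) (c' : V -> 'I_k) (v : W) (u : V)
    (W' : {set W}) (psi : W -> V) (D : {set V}) (B : {set {set V}}) :
  #|W| = #|V| ->
  (forall x y, adj T x y -> c x != c y) ->
  v \in W' -> psi v = u -> {in W' &, injective psi} ->
  {in W', forall x, c' (psi x) = c x} ->
  u \notin D -> (forall e, e \in B -> #|e| = 2 /\ u \notin e) ->
  (forall y, c' y != c' u -> ~~ adj G u y -> y \in D) ->
  (forall x y, x != u -> y != u -> c' x != c' y -> ~~ adj G x y -> [set x; y] \in B) ->
  copy_degree H T v * #|V| ^ 3 <= copy_degree H G u * #|V| ^ 3 +
     2 ^ 2 ^ #|VH| * #|V| ^ #|VH| * ((#|~: W'| + #|D|) * #|V| + #|B|).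
Proof.
move=> WV Tc vW psiv psiI psic uD uB DP BP; set n := #|V|; set h := #|VH|; set C := 2 ^ 2 ^ h.
(* [Z], [Y1], [Y2] collect the lost copies: those using a vertex outside the domain
   of [psi], a non-edge at [u], a non-edge away from [u]. *)
pose X := [set P in copies H T | (v \in P.1) && (P.1 \subset W')].
pose Y0 := [set P in copies H G | u \in P.1].
pose Z := \bigcup_(w in ~: W') containing h [set v; w].
pose Y1 := \bigcup_(y in D) containing h [set u; y].
pose Y2 := \bigcup_(e in B) containing h (u |: e).
have Zle : #|Z| * n ^ 2 <= #|~: W'| * (C * n ^ h).
  rewrite /n -WV; apply: card_bigcup_containing => w; rewrite inE => wW.
  by rewrite cards2; case: eqP wW => [<-|//]; rewrite vW.
have Y1le : #|Y1| * n ^ 2 <= #|D| * (C * n ^ h).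
  apply: card_bigcup_containing => y yD; rewrite cards2.
  by case: eqP yD => [<-|//]; rewrite (negbTE uD).
have Y2le : #|Y2| * n ^ 3 <= #|B| * (C * n ^ h).
  by apply: card_bigcup_containing => e /uB[e2 ue]; rewrite cardsU1 ue e2.
have dT : copy_degree H T v <= #|X| + #|Z|.
  apply: leq_trans (leq_card_setU _ _).1; apply: subset_leq_card; apply/subsetP=> P.
  rewrite in_set => /andP[Pc vP]; rewrite in_setU in_set Pc vP /=.
  case: (boolP (P.1 \subset W')) => //= /subsetPn[w wP wW].
  apply/bigcupP; exists w; first by rewrite inE.
  apply: (copies_containing Pc).
  by apply/subsetP=> z; rewrite !inE => /orP[]/eqP->.
have Xle : #|X| <= #|Y0| + #|Y1| + #|Y2|.
  (* A left inverse of [psi] on [W']; the value [v] off the image is arbitrary. *)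
  pose phi y := odflt v [pick x in W' | psi x == y].
  have psiK : {in W', cancel psi phi}.
    move=> x xW; rewrite /phi; case: pickP => [z /andP[zW /eqP e]|/(_ x)] /=.
      exact: psiI.
    by rewrite xW eqxx.
  rewrite -(@card_in_imset _ _ (push psi)); last first.
    apply: (can_in_inj (g := push phi)) => P; rewrite in_set => /and3P[Pc _ PW].
    exact: pushK psiK PW (copies_powerset Pc).
  apply: leq_trans (leq_add (leq_card_setU _ _).1 (leqnn _)).
  apply: leq_trans (leq_card_setU _ _).1.
  apply: subset_leq_card; apply/subsetP=> _ /imsetP[P + ->].
  rewrite in_set => /and3P[/copiesP[f [fI fH ->]] vf fW].
  have fW' b : f b \in W' by apply: (subsetP fW); rewrite imset_f.
  have gI : injective (psi \o f) by move=> a b /psiI e; apply: fI; apply: e.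
  have gu : u \in (psi \o f) @: [set: VH].
    case/imsetP: vf => a _ va; apply/imsetP; exists a => //=; by rewrite -va psiv.
  have gcont (S : {set V}) : S \subset (psi \o f) @: [set: VH] ->
      image_copy H (psi \o f) \in containing h S.
    move=> Sg; rewrite in_set /= Sg card_imset // cardsT eqxx /=.
    apply/subsetP=> _ /imsetP[e _ ->]; by rewrite inE imsetS // subsetT.
  have gcol a b : adj H a b -> c' (psi (f a)) != c' (psi (f b)).
    by move/fH/Tc; rewrite !psic.
  have gim b : psi (f b) \in (psi \o f) @: [set: VH] by apply/imsetP; exists b.
  rewrite push_image_copy !in_setU.
  (* Either every edge survives and the image is a copy in [G], or some edge [ab] is lost. Its ends
     have different colours, so the image is in [Y1] if one of them is sent to [u], and in [Y2]
     otherwise. *)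
  have [/existsP[a /existsP[b /andP[ab nab]]]|no] :=
      boolP [exists a, exists b, adj H a b && ~~ adj G (psi (f a)) (psi (f b))]; last first.
    suff -> : image_copy H (psi \o f) \in Y0 by [].
    rewrite in_set gu andbT; apply/copiesP; exists (psi \o f); split => // a b ab.
    move: no; rewrite negb_exists => /forallP/(_ a); rewrite negb_exists => /forallP/(_ b).
    by rewrite ab negbK.
  have Y1P y : y \in (psi \o f) @: [set: VH] -> c' y != c' u -> ~~ adj G u y ->
      image_copy H (psi \o f) \in Y1.
    move=> yg cy ny; apply/bigcupP; exists y; first exact: DP.
    by apply: gcont; apply/subsetP=> z; rewrite !inE => /orP[]/eqP->.
  have cab := gcol a b ab.
  have [au|au] := eqVneq (psi (f a)) u.
    by rewrite (Y1P (psi (f b))) ?orbT // -?au // eq_sym.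
  have [bu|bu] := eqVneq (psi (f b)) u.
    by rewrite (Y1P (psi (f a))) ?orbT // -?bu // adj_sym.
  apply/orP; right; apply/bigcupP; exists [set psi (f a); psi (f b)]; first exact: BP.
  by apply: gcont; apply/subsetP=> z; rewrite !inE => /or3P[]/eqP->.
have dT' : copy_degree H T v <= #|Y0| + #|Y1| + #|Y2| + #|Z|.
  by apply: leq_trans dT _; rewrite leq_add2r.
apply: leq_trans (leq_mul dT' (leqnn _)) _.
have Z3 := leq_mul Zle (leqnn n); have Y13 := leq_mul Y1le (leqnn n).
rewrite -!mulnA -expnSr in Z3 Y13.
rewrite -[copy_degree H G u]/#|Y0| !mulnDl -!addnA leq_add2l; nia.
Qed.

(** A proper colouring of [H] into the classes of [T] guides the embedding: one vertex [a] is put at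
    [v], and each of the others chooses freely among [q] vertices of its class reserved for it. *)
Lemma copy_degree_lower (VH W : finType) (H : sgraph VH) (T : sgraph W) k
    (c : W -> 'I_k) v q :
  (forall x y, adj T x y = (c x != c y)) -> colorable H k -> 0 < #|VH| -> 0 < q ->
  (forall i, q * #|VH| <= #|[set x | c x == i] :\ v|) ->
  q ^ #|VH|.-1 <= copy_degree H T v.
Proof.
move=> Tc /existsP[cH0 cH0P] VH0 q0 qle; have /card_gt0P[a _] := VH0; set h := #|VH|.
(* Swapping two colours gives [a] the colour of [v]. *)
have [cH cHP cHa] : exists2 cH : VH -> 'I_k,
    forall x y, adj H x y -> cH x != cH y & cH a = c v.
  exists (fun x => tperm (cH0 a) (c v) (cH0 x)); last by rewrite tpermL.
  move=> x y xy; rewrite (inj_eq perm_inj).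
  by have /forallP/(_ x)/forallP/(_ y)/implyP := cH0P; apply.
(* The vertex [b] is sent into its own block of [q] consecutive vertices of its
   colour class, so the vertex set of the copy determines [s]. *)
pose A i := enum ([set x | c x == i] :\ v).
have Asz i : q * h <= size (A i) by rewrite -cardE.
pose idx (b : VH) (j : 'I_q) := j * h + enum_rank b.
have idxlt (b : VH) (j : 'I_q) : idx b j < q * h.
  by rewrite /idx; have := ltn_ord j; have := ltn_ord (enum_rank b); rewrite -/h; nia.
pose f (s : {ffun VH -> 'I_q}) b := if b == a then v else nth v (A (cH b)) (idx b (s b)).
have fmem s b : b != a -> f s b != v /\ c (f s b) = cH b.
  move=> ba; have : f s b \in A (cH b).
    by rewrite /f (negbTE ba) mem_nth // (leq_trans (idxlt _ _)).
  by rewrite mem_enum !inE => /andP[? /eqP].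
have fc s b : c (f s b) = cH b.
  have [->|ba] := eqVneq b a; first by rewrite /f eqxx cHa.
  by have [] := fmem s b ba.
have fdet s s' b b' : b != a -> f s b = f s' b' -> b = b' /\ s b = s' b.
  move=> ba e; have b'a : b' != a.
    by apply/eqP=> b'a; have [/eqP + _] := fmem s b ba; rewrite e b'a /f eqxx.
  have cc : cH b = cH b' by rewrite -(fc s) e fc.
  move/eqP: e; rewrite /f (negbTE ba) (negbTE b'a) cc nth_uniq ?enum_uniq //;
    try exact: leq_trans (idxlt _ _) (Asz _).
  move/eqP => e.
  (* The positions open to [b] form a residue class modulo [h], so reduction modulo [h] recovers
     [b]. *)
  have er : enum_rank b = enum_rank b' :> nat.
    have := congr1 (modn^~ h) e; rewrite /= /idx !modnMDl !modn_small //; exact: ltn_ord.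
  have bb : b = b' by apply: enum_rank_inj; apply: val_inj.
  split => //; apply: val_inj; move/eqP: e; rewrite /idx -bb eqn_add2r.
  by rewrite eqn_pmul2r // => /eqP.
have fI s : injective (f s).
  move=> b b'; have [->|ba] := eqVneq b a; last by move/fdet; case.
  have [->//|b'a] := eqVneq b' a; by move/esym/fdet; case=> // ->.
(* As [f s] ignores [s a], that value is fixed; otherwise different [s] would give the same copy. *)
pose S := pffun_on (Ordinal q0) (predC1 a) (@predT 'I_q).
have <- : #|S| = q ^ h.-1.
  rewrite card_pffun_on card_ord; congr (_ ^ _).
  by have := cardC1 a; rewrite -/h => <-.
rewrite -(@card_in_imset _ _ (fun s => image_copy H (f s))) => [|s s' sS s'S [e _]].
  apply: subset_leq_card; apply/subsetP => _ /imsetP[s _ ->]; rewrite in_set.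
  apply/andP; split; last by apply/imsetP; exists a; rewrite // /f eqxx.
  apply/copiesP; exists (f s); split => // x y /cHP; by rewrite Tc !fc.
apply/ffunP=> b; have [->|ba] := eqVneq b a.
  have out s0 : s0 \in S -> s0 a = Ordinal q0.
    move=> /pffun_onP[/subsetP/(_ a) sup _]; apply/eqP; apply: contraT => /sup.
    by rewrite inE eqxx.
  by rewrite !out.
have : f s b \in f s' @: [set: VH] by rewrite -e imset_f.
by case/imsetP=> b' _ /fdet; case=> // _ ->.
Qed.

(** * Typical vertices of a graph close to the Turán graph *)

(** When [c] is the colouring of a complete multipartite [T], these are the neighbours of [x] in [T]
    that it lacks in [G]. *)
Definition missed (V : finType) (G : sgraph V) k (c : V -> 'I_k) x :=
  [set y | (c y != c x) && ~~ adj G x y].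

(** Every ordered pair counted on the left lies in [e * e] for a missing edge [e], which has four
    elements. *)
Lemma sum_missed (V : finType) (G T : sgraph V) k (c : V -> 'I_k) :
  (forall x y, adj T x y = (c x != c y)) ->
  \sum_x #|missed G c x| <= 4 * #|edges T :\: edges G|.
Proof.
move=> Tc; have -> : \sum_x #|missed G c x| = #|[set q : V * V | q.2 \in missed G c q.1]|.
  rewrite -sum1_card (eq_bigl (fun q : V * V => true && (q.2 \in missed G c q.1))); last first.
    by move=> q; rewrite inE.
  rewrite -(pair_big_dep xpredT (fun x y => y \in missed G c x) (fun _ _ => 1)) /=.
  by apply: eq_bigr => x _; rewrite sum1_card.
have sub : [set q : V * V | q.2 \in missed G c q.1] \subset
    \bigcup_(e in edges T :\: edges G) setX e e.
  apply/subsetP=> -[x y]; rewrite !inE /= => /andP[cxy nxy].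
  apply/bigcupP; exists [set x; y]; last by rewrite !inE !eqxx orbT.
  by rewrite inE -/(adj G x y) nxy -/(adj T x y) Tc eq_sym.
apply: leq_trans (subset_leq_card sub) _; apply: leq_trans (card_bigcup_le _ _) _.
rewrite mulnC -sum_nat_const; apply: leq_sum => e; rewrite inE => /andP[_ /card_edge e2].
by rewrite cardsX e2.
Qed.

Lemma turan_part (V : finType) k (T : sgraph V) (c : V -> 'I_k) i :
  (forall i, #|[set x | c x == i]| \in [:: #|V| %/ k; (#|V| + k.-1) %/ k]) ->
  #|V| %/ k <= #|[set x | c x == i]| <= (#|V| %/ k).+1.
Proof.
have k0 : 0 < k := leq_ltn_trans (leq0n _) (ltn_ord i).
move=> /(_ i); rewrite !inE => /orP[]/eqP->; first by rewrite leqnn leqnSn.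
rewrite leq_div2r ?leq_addr //= -addn1 -(divnDMl 1 _ k0) mul1n leq_div2r // leq_add2l; lia.
Qed.

(** By Markov's inequality at most n/(4k) vertices miss more than n/p others, while a part has about
    n/k vertices. The lower bound on n leaves room for [m] typical ones besides [u]. *)
Lemma typical_vertices (V : finType) (G T : sgraph V) k (c : V -> 'I_k) p m i u :
  (forall x y, adj T x y = (c x != c y)) ->
  #|V| %/ k <= #|[set x | c x == i]| ->
  #|edges T :\: edges G| * (16 * k * p) <= #|V| ^ 2 ->
  4 * k * m.+2 <= #|V| ->
  exists M : {set V}, [/\ M \subset [set x | c x == i], #|M| = m, u \notin M &
    forall x, x \in M -> #|missed G c x| * p <= #|V|].
Proof.
move=> Tc part BV nV; set n := #|V| in part BV nV *.
have k0 : 0 < k := leq_ltn_trans (leq0n _) (ltn_ord i).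
pose bad := [set x | n < #|missed G c x| * p].
have bad_le : #|bad| * (4 * k) <= n.
  have : #|bad| * n <= 4 * #|edges T :\: edges G| * p.
    apply: leq_trans (leq_mul (sum_missed G Tc) (leqnn p)).
    rewrite -sum_nat_const big_distrl [leqRHS](bigID (mem bad)) /=.
    apply: leq_trans (leq_addr _ _); apply: leq_sum => x.
    by rewrite inE => /ltnW.
  have n0 : 0 < n by nia.
  move=> le; rewrite -(leq_pmul2r n0); nia.
pose A := ([set x | c x == i] :\: bad) :\ u.
have mA : m <= #|A|.
  have h1 : #|[set x | c x == i]| <= #|[set x | c x == i] :\: bad| + #|bad|.
    rewrite -(cardsID bad [set x | c x == i]) addnC leq_add2l.
    by apply: subset_leq_card; apply: subsetIr.
  have h2 := cardsD1 u ([set x | c x == i] :\: bad).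
  have h3 : n < (n %/ k).+1 * k by rewrite ltn_ceil.
  have h4 : #|A| + 1 + #|bad| >= n %/ k.
    by move: h2 (leq_trans part h1); rewrite -/A; case: (u \in _); lia.
  move: h3 h4 bad_le nV; clear -k0; move: #|A| #|bad| (n %/ k) => a b d; nia.
have [M MA cM] := subset_of_card A m; exists M; split.
- apply: subset_trans MA _; apply: subset_trans (subD1set _ _) _; exact: subsetDl.
- by rewrite cM; apply/minn_idPl.
- by apply/negP => /(subsetP MA); rewrite !inE eqxx.
- by move=> x /(subsetP MA); rewrite !inE -leqNgt => /and3P[].
Qed.

(** * The exchange argument and the order of magnitude of the degree *)

Lemma copy_degree_turan_le (VH VF V W : finType) (H : sgraph VH) (F : sgraph VF)
    (G T0 : sgraph V) (T : sgraph W) k u v p :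
  is_free F G -> num_copies H G = gen_turan #|V| H F ->
  is_turan k T0 -> is_turan k T -> #|W| = #|V| ->
  edit_distance G T0 * (16 * k * p) <= #|V| ^ 2 ->
  4 * k * #|VF|.+2 <= #|V| -> 2 * k * p <= #|V| ->
  copy_degree H T v * (#|V| * p) <= copy_degree H G u * (#|V| * p) +
     2 ^ 2 ^ #|VH| * #|VF|.+2 * #|V| ^ #|VH|.
Proof.
move=> Gfree Gmax [c0 T0c c0part] [c Tc cpart] WV edit nF np.
have part0 i := turan_part T0 i c0part; have part i := turan_part T i cpart.
(* Pairs at [u] are left out: after reattaching, the missing edges at [u] are governed by [D]. *)
pose B := [set e in edges T0 :\: edges G | u \notin e].
have BT : #|B| <= #|edges T0 :\: edges G|.
  by apply: subset_leq_card; apply/subsetP=> e; rewrite inE => /andP[].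
have Bedit : #|edges T0 :\: edges G| * (16 * k * p) <= #|V| ^ 2.
  by apply: leq_trans edit; rewrite leq_mul2r subset_leq_card ?orbT // subsetUr.
have /andP[p0 _] := part0 (c v).
have [M [Mpart cM uM Mtyp]] := typical_vertices u T0c p0 Bedit nF.
pose N := [set y | (y != u) && [forall x in M, adj G x y]].
have uN : u \notin N by rewrite inE eqxx.
pose G' := reattach G u N.
have G'free : is_free F G'.
  apply: (reattach_free Gfree uM _ uN); first by rewrite cM.
  by move=> x y xM; rewrite inE => /andP[_ /forall_inP]; apply.
have G'G : copy_degree H G' u <= copy_degree H G u.
  apply: copy_degree_le => [x y xu yu|]; first exact: reattach_off.
  by rewrite Gmax num_copies_le_gen_turan.
(* Whatever its part in [T0], the vertex [u] now takes the colour of [v]. *)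
pose c' x := if x == u then c v else c0 x.
have c'u : c v = c' u by rewrite /c' eqxx.
(* The constant 2 allows for class sizes differing by one and for the removal of [u] from its class
   in [T0]. *)
have [i|W' [psi [vW W'le psiv psiI psic]]] := @coloured_injection _ _ _ c c' v u 2 c'u.
  have -> : [set x | c' x == i] :\ u = [set x | c0 x == i] :\ u.
    by apply/setP=> x; rewrite !inE /c'; case: (x == u).
  have := cardsD1 v [set x | c x == i]; have := cardsD1 u [set x | c0 x == i].
  have := part0 i; have := part i; rewrite WV; lia.
pose D := \bigcup_(x in M) (missed G c0 x :\ u).
have cD : #|D| * p <= #|VF| * #|V|.
  apply: leq_trans (leq_mul (card_bigcup_le _ _) (leqnn _)) _.
  rewrite big_distrl -cM -sum_nat_const; apply: leq_sum => x xM /=.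
  apply: leq_trans (Mtyp x xM); rewrite leq_mul2r subset_leq_card ?orbT //.
  exact: subD1set.
have compare := @copy_degree_compare _ _ _ H G' T k c c' v u W' psi D B WV.
have {compare} : copy_degree H T v * #|V| ^ 3 <= copy_degree H G' u * #|V| ^ 3 +
     2 ^ 2 ^ #|VH| * #|V| ^ #|VH| * ((#|~: W'| + #|D|) * #|V| + #|B|).
  apply: compare => //.
  - by move=> x y; rewrite Tc.
  - by apply/negP => /bigcupP[x _]; rewrite !inE eqxx.
  - by move=> e; rewrite !inE => /andP[/andP[_ /card_edge ->] ->].
  (* A vertex outside [N] is not adjacent to some [x] in [M]. As [x] has the colour [c v] in [T0], a
     differently coloured [y] is missed by [x]. *)
  - move=> y; have [->|yu] := eqVneq y u; first by rewrite eqxx.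
    rewrite -c'u /c' (negbTE yu) reattach_at // in_set yu /= => c0y.
    rewrite negb_forall => /existsP[x]; rewrite negb_imply => /andP[xM nxy].
    apply/bigcupP; exists x => //; rewrite !inE yu nxy andbT.
    by have := subsetP Mpart _ xM; rewrite inE => /eqP ->.
  - move=> x y xu yu; rewrite /c' (negbTE xu) (negbTE yu) reattach_off // => cxy nxy.
    rewrite !inE -/(adj G x y) nxy -/(adj T0 x y) T0c cxy /=.
    by rewrite ![u == _]eq_sym (negbTE xu) (negbTE yu).
have k0 : 0 < k := leq_ltn_trans (leq0n _) (ltn_ord (c v)).
have Bp : #|B| * p <= #|V| ^ 2.
  by apply: leq_trans Bedit; apply: leq_mul => //; nia.
have n0 : 0 < #|V| by nia.
(* The sets [~: W'] and [B] contribute one unit of n^2 each, and [D] contributes [#|VF|] units. *)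
have err : ((#|~: W'| + #|D|) * #|V| + #|B|) * p <= #|VF|.+2 * #|V| ^ 2.
  have W'p : #|~: W'| * p <= #|V|.
    by apply: leq_trans np; rewrite leq_mul2r (mulnC 2) W'le orbT.
  move: W'p cD Bp; rewrite expnS expn1; clear.
  move: #|V| #|VF| #|D| #|B| #|~: W'| => n m d b w W'p cD Bp.
  have := leq_mul W'p (leqnn n); have := leq_mul cD (leqnn n); nia.
move=> le; have n2 : 0 < #|V| ^ 2 by rewrite expn_gt0 n0.
rewrite -(leq_pmul2r n2).
apply: (@leq_trans (copy_degree H T v * #|V| ^ 3 * p)).
  by rewrite (expnS _ 2); apply: eq_leq; ring.
apply: leq_trans (leq_mul le (leqnn p)) _.
rewrite [leqLHS]mulnDl [leqRHS]mulnDl; apply: leq_add.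
  apply: leq_trans (leq_mul (leq_mul G'G (leqnn _)) (leqnn p)) _.
  by rewrite (expnS _ 2); apply: eq_leq; ring.
rewrite -(mulnA _ _ p); apply: leq_trans (leq_mul (leqnn _) err) _.
by apply: eq_leq; ring.
Qed.

Lemma colorable_leq (V : finType) (G : sgraph V) a b :
  a <= b -> colorable G a -> colorable G b.
Proof.
move=> ab /existsP[c cP]; apply/existsP; exists [ffun x => widen_ord ab (c x)].
apply/forallP=> x; apply/forallP=> y; rewrite !ffunE.
by have /forallP/(_ x)/forallP/(_ y) := cP.
Qed.

(** With [q] about n/(2kh), the candidates fill about half of a part, leaving room for rounding and
    for [v]. Conversely n is at most [4 * k * h * q], which turns q^(h-1) into a multiple of
    n^(h-1). *)
Lemma copy_degree_turan_ge (VH W : finType) (H : sgraph VH) (T : sgraph W) k v :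
  is_turan k T -> colorable H k -> 0 < #|VH| -> 4 * k * #|VH| <= #|W| ->
  #|W| ^ #|VH| <= (4 * k * #|VH|) ^ #|VH|.-1 * (#|W| * copy_degree H T v).
Proof.
move=> [c Tc cpart] Hk h0 nW.
have k0 : 0 < k := leq_ltn_trans (leq0n _) (ltn_ord (c v)).
have hk0 : 0 < 2 * k * #|VH| by rewrite !muln_gt0 k0.
set q := #|W| %/ (2 * k * #|VH|).
have q0 : 0 < q by rewrite divn_gt0 //; lia.
have nq : #|W| <= 4 * k * #|VH| * q.
  have := ltn_ceil #|W| hk0; rewrite -/q; nia.
have qpart i : q * #|VH| <= #|[set x | c x == i] :\ v|.
  have /andP[le _] := turan_part T i cpart.
  have := cardsD1 v [set x | c x == i].
  have qk : q * #|VH| * (2 * k) <= #|W|.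
    by apply: leq_trans (leq_trunc_div #|W| (2 * k * #|VH|)); apply: eq_leq; rewrite -/q; ring.
  have wk : #|W| < (#|W| %/ k).+1 * k by rewrite ltn_ceil.
  have : q * #|VH| + 1 <= #|W| %/ k.
    have kh : 4 * k <= #|W| by nia.
    move: qk wk kh; clear -k0; move: (q * _) #|W| (_ %/ k) => a n d; nia.
  by move: le; case: (v \in _); lia.
have := copy_degree_lower Tc Hk h0 q0 qpart.
move: h0 nq; clear; case: #|VH| => //= h _ nq le.
rewrite expnS mulnCA leq_mul2l; apply/orP; right.
apply: leq_trans (leq_mul (leqnn _) le); rewrite -expnMn.
by case: h nq {le} => [|h] nq; rewrite ?expn0 ?leq_exp2r.
Qed.

(** * Choice of constants and conclusion *)

Local Open Scope ring_scope.

Theorem theorem1p6 (R : realType) (VH VF : finType) (H : sgraph VH)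
    (F : sgraph VF) (k : nat)
    (chiHF : (chromatic_number H < chromatic_number F)%N)
    (chiF : chromatic_number F = k.+1)
    (stableHF : turan_stable R k H F) :
  forall eps : R, 0 < eps ->
  exists n0 : nat,
  forall (n : nat) (V : finType) (G : sgraph V),
    (n0 <= n)%N -> #|V| = n -> is_free F G -> num_copies H G = gen_turan n H F ->
  forall (W : finType) (T : sgraph W), #|W| = n -> is_turan k T ->
  forall (u : V) (v : W),
    (1 - eps) * (copy_degree H T v)%:R <= (copy_degree H G u)%:R.
Proof.
move=> eps eps0.
have Hk : colorable H k.
  move: chiHF; rewrite chiF ltnS; apply: contraLR => nH; rewrite -ltnNge.
  rewrite /chromatic_number; case: ex_minnP => a aH _; rewrite ltnNge.
  by apply: contra nH => ak; apply: colorable_leq aH.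
(* If [H] has no vertices, its copies contain no vertex and the left-hand side vanishes. *)
have [VH0|VH0] := posnP #|VH|.
  exists 0%N => n V G _ _ _ _ W T _ _ u v; rewrite (_ : copy_degree H T v = 0%N).
    by rewrite mulr0 ler0n.
  apply/eqP; rewrite cards_eq0; apply/eqP/setP=> P; rewrite in_set in_set0.
  by apply/andP=> -[/copies_card]; rewrite VH0 => /cards0_eq ->; rewrite inE.
have [k0|k0] := posnP k.
  exists 0%N => n V G _ _ _ _ W T _ [c _ _] u v.
  by have := ltn_ord (c v); rewrite {2}k0.
pose s := (Num.bound eps^-1).+1.
have s_eps : 1 <= eps * s%:R.
  rewrite mulrC -ler_pdivrMr // mul1r; apply: ltW.
  apply: lt_le_trans (archi_boundP _) _; first by rewrite invr_ge0 ltW.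
  by rewrite ler_nat leqnSn.
(* [C] multiplies the constants of the upper and lower estimates, so that with [p = s * C] the error
   is at most a fraction 1/s of the degree of [v], hence at most [eps] times it. *)
pose C := (2 ^ 2 ^ #|VH| * #|VF|.+2 * (4 * k * #|VH|) ^ #|VH|.-1)%N.
pose p := (s * C)%N.
have p0 : (0 < p)%N by rewrite !muln_gt0 !expn_gt0 !muln_gt0 k0 VH0.
have kp0 : (0 < 16 * k * p)%N by rewrite muln_gt0 p0 muln_gt0 k0.
have [|delta [n1 [delta0 stable]]] := stableHF (16 * k * p)%:R^-1.
  by rewrite invr_gt0 ltr0n.
exists (n1 + 4 * k * #|VF|.+2 + 2 * k * p + 4 * k * #|VH|)%N.
move=> n V G nn Vn Gfree Gmax W T Wn Tturan u v.
(* An extremal [G] meets the stability hypothesis whatever [delta] is. *)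
have [||T0 T0turan] := stable n V G _ Vn Gfree; first by lia.
  by rewrite Gmax gerBl mulr_ge0 ?exprn_ge0 // ltW.
rewrite mulrC ler_pdivlMr ?ltr0n // -natrX -natrM ler_nat => edit.
have upper : (copy_degree H T v * (#|V| * p) <= copy_degree H G u * (#|V| * p) +
     2 ^ 2 ^ #|VH| * #|VF|.+2 * #|V| ^ #|VH|)%N.
  apply: (copy_degree_turan_le u v Gfree _ T0turan Tturan); rewrite ?Vn ?Wn //; lia.
have lower := copy_degree_turan_ge v Tturan Hk VH0.
rewrite Wn Vn in upper lower.
have {}lower : (n ^ #|VH| <= (4 * k * #|VH|) ^ #|VH|.-1 * (n * copy_degree H T v))%N.
  by apply: lower; lia.
have n0 : (0 < n)%N by nia.
have nC0 : (0 < n * C)%N by rewrite muln_gt0 n0; move: p0; rewrite muln_gt0 => /andP[].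
(* This is the claim with 1/s in place of [eps], multiplied by [s]; the lower estimate absorbs the
   term of order n^h into the degree of [v]. *)
have key : (copy_degree H T v * s <= copy_degree H G u * s + copy_degree H T v)%N.
  rewrite -(leq_pmul2r nC0).
  apply: (@leq_trans (copy_degree H T v * (n * p))); first by apply: eq_leq; rewrite /p; ring.
  apply: leq_trans upper _; rewrite [leqRHS]mulnDl; apply: leq_add.
    by apply: eq_leq; rewrite /p; ring.
  apply: leq_trans (leq_mul (leqnn _) lower) _.
  by apply: eq_leq; rewrite /C; ring.
have s0 : (0 : R) < s%:R by rewrite ltr0n.
rewrite -(ler_pM2r s0).
move: key; rewrite -(ler_nat R) natrD !natrM => key.
have d0 : (0 : R) <= (copy_degree H T v)%:R by rewrite ler0n.
nra.
Qed.
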